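(* For every integer $n \geqslant 19$, the graph $\mathfrak{R}_{S_n}$ has a Hamiltonian cycle.
   Context: $S_n$ denotes the symmetric group on $\{1,\ldots,n\}$. For a finite group $G$, let $\mathcal{N}_G$ be the simple graph whose vertices are the elements of $G$, with $x, y \in G$ joined by an edge if and only if the subgroup $\langle x, y\rangle$ is not nilpotent. The non-nilpotent graph $\mathfrak{R}_G$ is the graph obtained from $\mathcal{N}_G$ by removing all isolated vertices. *)

(* Defs.v *)
From mathcomp Require Import all_boot all_fingroup all_solvable.

Set Implicit Arguments.
Unset Strict Implicit.
Unset Printing Implicit Defensive.

Import GroupScope.

(* A finite simple graph is given by a vertex set V : {set T} and a symmetric
   irreflexive adjacency relation e : rel T, only its restriction to V being
   relevant. *)

Definition nonisolated (T : finType) (V : {set T}) (e : rel T) : {set T} :=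
  [set x in V | [exists y in V, e x y]].

(* A cycle of a simple graph has at least three vertices; without this
   condition, [::] and a single edge would count as cycles. *)
Definition hamiltonian (T : finType) (V : {set T}) (e : rel T) : Prop :=
  exists c : seq T, [/\ 2 < size c, ucycle e c & c =i V].

Section NonNilpotentGraph.

Variable gT : finGroupType.
Implicit Types (x y : gT) (G : {group gT}).

Definition nonnil_adj : rel gT :=
  fun x y => ~~ nilpotent <<[set x; y]>>.

Lemma nonnil_adj_sym : symmetric nonnil_adj.
Proof. by move=> x y; rewrite /nonnil_adj setUC. Qed.

Lemma nonnil_adj_irr : irreflexive nonnil_adj.
Proof.
by move=> x; rewrite /nonnil_adj setUid abelian_nil ?cycle_abelian.
Qed.

(* The vertex set of the non-nilpotent graph of G, whose adjacency relation is
   nonnil_adj. *)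
Definition nonnil_vertices G : {set gT} := nonisolated G nonnil_adj.

Definition nonnil_graph_hamiltonian G : Prop :=
  hamiltonian (nonnil_vertices G) nonnil_adj.

End NonNilpotentGraph.

(* Main.v *)
Require Import Defs.
From mathcomp Require Import all_boot all_fingroup all_solvable zify.
Set Implicit Arguments.
Unset Strict Implicit.
Unset Printing Implicit Defensive.

(** The graph satisfies the hypothesis of Dirac's theorem: every x <> 1 in S_n
forms a nilpotent subgroup with at most half of the elements y of S_n
([card_nilpotentiser]).  In particular the vertices of the graph are the
nontrivial permutations, and each is adjacent to at least half of them.

To bound the number of such y, take a prime p dividing the order of x and
replace x by its p-part.  In a nilpotent group elements of coprime orders
commute, so x commutes with y ^+ N, where N is the p-part of n`!
([nilpotent_power_centraliser]).  Fix a point a moved by x, and let b = x a.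
- If a and b lie in different cycles of y, of lengths v and u, then u and v have
  the same p'-part ([split_class_part]); there are few such pairs (u, v).
- If a and b lie in the same cycle of y, of length L = u + v with
  a = y ^+ u b, then x must send the point y ^+ N a of this cycle to the point
  y ^+ N b.  Except when L divides N or when N is congruent to u modulo L, this
  is an additional constraint on y ([card_joint_generic]).
Any pair (u, v) is realised by at most (n - 2)`! permutations y in each of the
two cases, and by at most (n - 2)`! / (n - 3) when the additional constraint is
present.  The count rests on an injection from permutations, seen as products of
cycles, to permutations seen as words ([word_count]): the cycles of y through b
and a become a prefix of the word, in which b and a occupy the positions 0 and u.
The exceptional pairs number O(n log n), against n (n - 1) for the quotient of
n`! by (n - 2)`!, and the resulting bound is below n`! / 2 as soon as n >= 19
([card_power_centraliser]). *)

(** * Dirac's theorem *)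

(** A cyclic arrangement of the vertices is a Hamiltonian cycle when it has no
gap, that is no consecutive non-adjacent pair; Dirac's theorem is proved by
decreasing the number of gaps. *)
Fixpoint gaps (T : eqType) (e : rel T) (x : T) (s : seq T) : nat :=
  if s is y :: s' then ~~ e x y + gaps e y s' else 0.

Lemma gaps_cat (T : eqType) (e : rel T) x s t :
  gaps e x (s ++ t) = gaps e x s + gaps e (last x s) t.
Proof. by elim: s x => //= y s IHs x; rewrite IHs addnA. Qed.

Lemma gaps_rev (T : eqType) (e : rel T) x s :
  symmetric e -> gaps e (last x s) (rev (belast x s)) = gaps e x s.
Proof.
move=> e_sym; elim: s x => //= y s IHs x.
rewrite rev_cons -cats1 gaps_cat IHs addnC /= addn0.
by case: s {IHs} => [|z s] /=; rewrite ?rev_cons ?last_rcons e_sym.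
Qed.

Lemma gaps_eq0 (T : eqType) (e : rel T) x s : (gaps e x s == 0) = path e x s.
Proof. by elim: s x => //= y s IHs x; rewrite addn_eq0 eqb0 negbK IHs. Qed.

Lemma path_gap (T : eqType) (e : rel T) x s :
  ~~ path e x s ->
  exists s1 y s2, s = s1 ++ y :: s2 /\ ~~ e (last x s1) y.
Proof.
elim: s x => //= y s IHs x.
have [exy|nexy] := boolP (e x y) => /=; last by exists [::], y, s.
by case/IHs=> s1 [z [s2 [-> gap]]]; exists (y :: s1), z, s2.
Qed.

(** Pigeonhole principle: the pairs of consecutive entries of x :: s number
[size s]. *)
Lemma count_split (T : eqType) (P Q : pred T) x s :
    size s < count P (belast x s) + count Q s ->
  exists s1 y s2, [/\ s = s1 ++ y :: s2, P (last x s1) & Q y].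
Proof.
elim: s x => //= y s IHs x.
have [/andP[Px Qy] _|] := boolP (P x && Q y); first by exists [::], y, s.
move=> nPQ lts; case: (IHs y) => [|s1 [z [s2 [-> Pz Qz]]]].
  by case: (P x) (Q y) nPQ lts => [] [] //= _; lia.
by exists (y :: s1), z, s2.
Qed.

(** A gap between the last entry u of v :: s and its first entry v is removed by
reversing a prefix: by the degree condition some consecutive entries h, z are
such that u is adjacent to h and v to z; reversing the prefix ending at h
replaces the pairs (h, z) and (u, v) by (v, z) and (u, h). *)
Lemma close_gap (T : eqType) (e : rel T) v s :
    symmetric e -> irreflexive e ->
    (forall x, x \in v :: s -> size (v :: s) <= 2 * count (e x) (v :: s)) ->
    ~~ e (last v s) v ->
  exists w t, perm_eq (w :: t) (v :: s) /\
    gaps e w (rcons t w) < gaps e v (rcons s v).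
Proof.
move=> e_sym e_irr deg gap.
have deg_v := deg v (mem_head v s); have deg_u := deg _ (mem_last v s).
have [s1 [z [s2 [def_s eu ev]]]] :
    exists s1 y s2, [/\ s = s1 ++ y :: s2, e (last v s) (last v s1) & e v y].
  apply: count_split; move: deg_v deg_u => /=.
  rewrite -/(count (e (last v s)) (v :: s)) lastI -cats1 count_cat /= !e_irr.
  by lia.
exists (last v s1), (rev (belast v s1) ++ z :: s2); split.
  rewrite def_s -cat_cons -[v :: s1 ++ _]/((v :: s1) ++ z :: s2) perm_cat2r.
  by rewrite -rev_rcons -lastI perm_rev.
have last_rev : last (last v s1) (rev (belast v s1)) = v.
  by case: (s1) => //= y r; rewrite rev_cons last_rcons.
have last_s : last v s = last z s2 by rewrite def_s last_cat.
rewrite -!cats1 !gaps_cat gaps_rev // last_rev last_cat /= -last_s eu ev.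
by rewrite gap {1}def_s gaps_cat /= addn0; lia.
Qed.

(** Rotating a cyclic arrangement preserves its gaps and allows the gap to be
closed to sit at its end. *)
Lemma rotate_gap (T : eqType) (e : rel T) v s :
    0 < gaps e v (rcons s v) ->
  exists w t, [/\ perm_eq (w :: t) (v :: s), ~~ e (last w t) w
    & gaps e w (rcons t w) = gaps e v (rcons s v)].
Proof.
rewrite lt0n gaps_eq0 => /path_gap[s1 [y [s2 [def_s gap]]]].
case/lastP: s2 def_s => [|s2 z].
  rewrite cats1 => /rcons_inj[def_s def_v]; exists v, s.
  by rewrite perm_refl def_s {2}def_v.
rewrite -rcons_cons -rcons_cat => /rcons_inj[-> _].
exists y, (s2 ++ v :: s1); split.
- by rewrite -cat_cons perm_catC.
- by rewrite last_cat.
rewrite -!cats1 -!catA !gaps_cat /= gap !addn0; lia.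
Qed.

Theorem dirac (T : finType) (V : {set T}) (e : rel T) :
    symmetric e -> irreflexive e -> 2 < #|V| ->
    (forall x, x \in V -> #|V| <= 2 * #|[set y in V | e x y]|) ->
  hamiltonian V e.
Proof.
move=> e_sym e_irr V_gt2 deg.
have deg_c c : perm_eq c (enum V) ->
    forall x, x \in c -> size c <= 2 * count (e x) c.
  move=> cV x; rewrite (perm_mem cV) mem_enum => /deg.
  rewrite (perm_size cV) -cardE (seq.permP cV) => /leq_trans-> //.
  rewrite leq_mul2l /= -size_filter cardE uniq_leq_size ?enum_uniq // => y.
  by rewrite mem_enum inE mem_filter mem_enum andbC.
have [v0 [s0 V_s0]] : exists v s, perm_eq (v :: s) (enum V).
  by move: V_gt2; rewrite cardE; case: (enum V) => // v s _; exists v, s.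
have [v [s [sV gap0]]] : exists v s,
    perm_eq (v :: s) (enum V) /\ gaps e v (rcons s v) = 0.
  have [k] := ubnP (gaps e v0 (rcons s0 v0)).
  elim: k v0 s0 V_s0 => // k IHk v s sV lt_k.
  have [gap0|gap_gt0] := posnP (gaps e v (rcons s v)); first by exists v, s.
  have [w [t [/perm_trans/(_ sV)tV gap_t eq_t]]] := rotate_gap gap_gt0.
  have [w' [t' [tV' lt_t']]] := close_gap e_sym e_irr (deg_c _ tV) gap_t.
  apply: IHk (perm_trans tV' tV) _.
  by rewrite eq_t in lt_t'; apply: leq_trans lt_t' _.
exists (v :: s); split.
- by rewrite (perm_size sV) -cardE.
- rewrite /ucycle /= -?gaps_eq0 ?gap0 //= -/(uniq (v :: s)) (perm_uniq sV).
  exact: enum_uniq.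
by move=> x; rewrite (perm_mem sV) mem_enum.
Qed.

(** * Permutations as words *)

Lemma iter_modn_porbit (T : finType) (y : {perm T}) c j :
  iter (j %% #|porbit y c|) y c = iter j y c.
Proof.
rewrite {2}(divn_eq j #|porbit y c|) addnC iterD; congr iter.
by elim: (_ %/ _) => //= q IHq; rewrite mulSn iterD -IHq iter_porbit.
Qed.

Lemma permX_fix (T : finType) (y : {perm T}) c j :
  ((y ^+ j)%g c == c) = (#|porbit y c| %| j).
Proof.
rewrite permX -iter_modn_porbit /dvdn.
have lt_r : j %% #|porbit y c| < #|porbit y c|.
  by rewrite ltn_mod (cardD1 c) porbit_id.
have := uniq_traject_porbit y c; set L := #|_| in lt_r *.
move: lt_r; case: L => // L lt_r U.
rewrite -(nth_traject _ lt_r) -[X in _ == X](nth_traject y (ltn0Sn L) c).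
by rewrite nth_uniq ?size_traject.
Qed.

(** Starting the listing of a cycle one step earlier compensates the action of
y. *)
Lemma map_rotr_traject (T : finType) (y : {perm T}) c k :
  iter k y c = c -> map y (rotr 1 (traject y c k)) = traject y c k.
Proof.
case: k => // k yk; rewrite {1}trajectSr rotr1_rcons /= -iterS yk.
by congr (_ :: _); elim: k c {yk} => //= k IHk c; rewrite IHk.
Qed.

Lemma prefix_perm n (b : 'I_n) (s : seq 'I_n) : uniq s ->
  exists w : 'S_n, forall j : 'I_n, j < size s -> w j = nth b s j.
Proof.
move=> Us; pose r := s ++ [seq c <- enum 'I_n | c \notin s].
have r_all c : c \in r by rewrite mem_cat mem_filter mem_enum andbT orbN.
have Ur : uniq r.
  rewrite cat_uniq Us filter_uniq ?enum_uniq // andbT.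
  by apply/hasPn=> c; rewrite mem_filter => /andP[].
have size_r : size r = n by rewrite -(card_uniqP Ur) (eq_card r_all) card_ord.
have inj_r : injective (fun j : 'I_n => nth b r j).
  by move=> i j /eqP; rewrite nth_uniq ?size_r // => /eqP/val_inj.
by exists (perm inj_r) => j ltj; rewrite permE nth_cat ltj.
Qed.

(** For y in A, let t y be a sequence of distinct points, of constant length k,
and let s = g (t y) be its preimage under y.  Choose for each s a permutation W s
with prefix s.  Then the permutation W s * y, which applies W s first, has prefix
t y; it determines t y, hence s and W s, hence y. *)
Lemma word_count n (A B : {set 'S_n}) (b : 'I_n)
    (t : 'S_n -> seq 'I_n) (k : nat)
    (g : seq 'I_n -> seq 'I_n) :
    (forall y, y \in A ->
       [/\ size (t y) = k, uniq (t y) & map y (g (t y)) = t y]) ->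
    (forall (y w : 'S_n), y \in A ->
       (forall j : 'I_n, j < k -> w j = nth b (t y) j) -> w \in B) ->
  #|A| <= #|B|.
Proof.
move=> tA tB.
pose W s : 'S_n := odflt 1%g
  [pick w : 'S_n | [forall j : 'I_n, (j < size s) ==> (w j == nth b s j)]].
have WE s (j : 'I_n) : uniq s -> j < size s -> W s j = nth b s j.
  move=> /(prefix_perm b)[w wP] ltj; rewrite /W.
  case: pickP => [w' /forallP/(_ j) | /(_ w)/forallP[]].
    by rewrite ltj => /eqP.
  by move=> i; apply/implyP=> /wP->.
pose F (y : 'S_n) := (W (g (t y)) * y)%g.
have FE y (j : 'I_n) : y \in A -> j < k -> F y j = nth b (t y) j.
  move=> /tA[<- Ut gt] ltj.
  have size_g : size (g (t y)) = size (t y) by rewrite -{2}gt size_map.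
  rewrite permM WE ?size_g //; last by apply: (@map_uniq _ _ y); rewrite gt.
  by rewrite -{2}gt (nth_map b) ?size_g.
suffices injF : {in A &, injective F}.
  rewrite -(card_in_imset injF) subset_leq_card //.
  by apply/subsetP=> _ /imsetP[y Ay ->]; apply: (tB y) => // j; apply: FE.
move=> y y' Ay Ay' eqF; have [st Ut _] := tA y Ay; have [st' _ _] := tA y' Ay'.
have le_k : k <= n.
  by rewrite -st -(card_uniqP Ut) (leq_trans (max_card _)) ?card_ord.
have eq_t : t y = t y'.
  apply: (@eq_from_nth _ b); first by rewrite st'.
  rewrite st => j ltj; pose j' := Ordinal (leq_trans ltj le_k).
  by rewrite -[j]/(val j') -!FE ?eqF.
by move: eqF; rewrite /F eq_t => /mulgI.
Qed.

Lemma card_perm2 n (p q b a : 'I_n) : p != q ->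
  #|[set w : 'S_n | (w p == b) && (w q == a)]| <= (n - 2)`!.
Proof.
move=> neq_pq; set B := [set w | _].
have [->|[w0]] := set_0Vmem B; first by rewrite cards0.
rewrite inE => /andP[/eqP w0p /eqP w0q].
have <- : #|~: [set p; q]| = n - 2 by rewrite cardsCs setCK cards2 neq_pq card_ord.
rewrite -card_perm -(card_imset _ (mulIg w0^-1%g)) subset_leq_card //.
apply/subsetP=> _ /imsetP[w + ->]; rewrite inE => /andP[/eqP wp /eqP wq].
rewrite unfold_in; apply/subsetP=> c; rewrite !inE permM.
by apply: contraNN => /orP[] /eqP ->; rewrite ?wp ?wq -?w0p -?w0q permK.
Qed.

(** Exchanging the value at r with the value at any t outside {p, q, s} leaves
the values at p, q and s unchanged, and w can be recovered from the result
because w r = f (w s) is known.  So each w yields n - 3 permutations with the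
prescribed values at p and q. *)
Lemma card_perm3 n (p q r s b a : 'I_n) (f : 'I_n -> 'I_n) :
    p != q -> r != p -> r != q -> s != r ->
  (n - 3) * #|[set w : 'S_n | [&& w p == b, w q == a & w r == f (w s)]]|
    <= (n - 2)`!.
Proof.
move=> neq_pq neq_rp neq_rq neq_sr; set B := [set w | _].
pose C := ~: [set p; q; s].
have C_ge : n - 3 <= #|C|.
  rewrite cardsCs setCK card_ord leq_sub2l //.
  by rewrite (leq_trans (leq_card_setU _ _)) ?cards1 ?cards2 ?neq_pq.
apply: leq_trans (leq_mul C_ge (leqnn _)) _.
rewrite mulnC -cardsX; apply: leq_trans (card_perm2 b a neq_pq).
pose h (wt : 'S_n * 'I_n) := (tperm r wt.2 * wt.1)%g.
have hp wt c : c != r -> c != wt.2 -> h wt c = wt.1 c.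
  by move=> cr ct; rewrite permM tpermD // eq_sym.
have hr wt : h wt wt.2 = wt.1 r by rewrite permM tpermR.
have BC wt : wt \in setX B C -> [/\ wt.1 p = b, wt.1 q = a, wt.1 r = f (wt.1 s)
    & [/\ p != wt.2, q != wt.2 & s != wt.2]].
  rewrite !inE !negb_or -!andbA => /and4P[/eqP-> /eqP-> /eqP-> /and3P[]].
  by rewrite !(eq_sym wt.2).
have inj_h : {in setX B C &, injective h}.
  move=> wt wt' /BC[_ _ wr [_ _ st]] /BC[_ _ wr' [_ _ st']] eq_h.
  have eq_s : wt.1 s = wt'.1 s by rewrite -!hp ?eq_h.
  have eq_r : wt.1 r = wt'.1 r by rewrite wr wr' eq_s.
  have eq_t : wt.2 = wt'.2.
    by apply: (@perm_inj _ (h wt)); rewrite hr eq_r -hr eq_h.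
  move: eq_h; rewrite /h eq_t => /mulgI.
  by case: wt wt' eq_t {wr wr' st st' eq_s eq_r} => [w t] [w' t'] /= -> ->.
rewrite -(card_in_imset inj_h) subset_leq_card //.
apply/subsetP=> _ /imsetP[wt /BC[wp wq _ [pt qt _]] ->].
by rewrite inE !hp ?wp ?wq ?eqxx // eq_sym.
Qed.

(** * Elements of which a power commutes with x *)

Lemma card_porbit_leq n (y : 'S_n) c : #|porbit y c| <= n.
Proof. by rewrite (leq_trans (max_card _)) ?card_ord. Qed.

Lemma card_porbit_gt0 (T : finType) (y : {perm T}) c : 0 < #|porbit y c|.
Proof. by rewrite (cardD1 c) porbit_id. Qed.

Section Commuting.

Variables (n : nat) (x : 'S_n) (a b : 'I_n) (N : nat).
Hypotheses (xa : x a = b) (neq_ab : a != b).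

Definition power_centraliser := [set y : 'S_n | (y ^+ N)%g \in 'C[x]%g].

Definition split_class (u v : nat) := [set y in power_centraliser |
  [&& a \notin porbit y b, #|porbit y b| == u & #|porbit y a| == v]].

(** The points b and a cut their common cycle into arcs of lengths u and v, so
that the pair (u, v) has the same range as in [split_class]. *)
Definition joint_class (u v : nat) := [set y in power_centraliser |
  (#|porbit y b| == u + v) && (iter u y b == a)].

Lemma commute_iter y c : y \in power_centraliser ->
  x (iter N y c) = iter N y (x c).
Proof.
by rewrite inE => /cent1P xy; rewrite -!permX -!permM xy.
Qed.

(** The word is formed by the cycle of y starting at b, followed by the cycle
starting at a.  Here and below o is position 0. *)
Lemma card_split_leq (o u : 'I_n) v : val o = 0 -> 0 < u -> 0 < v ->
  #|split_class u v| <= (n - 2)`!.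
Proof.
move=> o0 u_gt0 v_gt0; have neq_ou : o != u.
  by rewrite -val_eqE o0 /= eq_sym -lt0n.
apply: leq_trans (card_perm2 b a neq_ou).
pose g (s : seq 'I_n) := rotr 1 (take u s) ++ rotr 1 (drop u s).
apply: (@word_count _ _ _ b (fun y => traject y b u ++ traject y a v) (u + v) g).
  move=> y; rewrite inE => /and4P[_ nab /eqP Eu /eqP Ev].
  rewrite size_cat !size_traject; split=> //.
    rewrite cat_uniq -{1}Eu -{2}Ev !uniq_traject_porbit andbT /=.
    apply/hasPn=> c; rewrite -Ev -Eu -!porbit_traject => ca.
    apply: contra nab => cb; rewrite -eq_porbit_mem in ca.
    by rewrite -eq_porbit_mem -(eqP ca) eq_porbit_mem.
  rewrite /g take_size_cat ?drop_size_cat ?size_traject // map_cat.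
  by rewrite !map_rotr_traject // -?Eu -?Ev iter_porbit.
move=> y w _ wE; rewrite inE !wE ?o0 ?addn_gt0 ?u_gt0 //; last first.
  by rewrite -{1}[val u]addn0 ltn_add2l.
rewrite !nth_cat size_traject u_gt0 ltnn subnn -(prednK u_gt0) -(prednK v_gt0).
by rewrite /= !eqxx.
Qed.

Lemma joint_word (y : 'S_n) u v : y \in joint_class u v ->
  [/\ size (traject y b (u + v)) = u + v, uniq (traject y b (u + v))
    & map y (rotr 1 (traject y b (u + v))) = traject y b (u + v)].
Proof.
rewrite inE => /and3P[_ /eqP L _]; rewrite size_traject -L.
by rewrite uniq_traject_porbit map_rotr_traject ?iter_porbit.
Qed.

Lemma card_joint_leq (o u : 'I_n) v : val o = 0 -> 0 < u -> 0 < v ->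
  #|joint_class u v| <= (n - 2)`!.
Proof.
move=> o0 u_gt0 v_gt0; have neq_ou : o != u.
  by rewrite -val_eqE o0 /= eq_sym -lt0n.
apply: leq_trans (card_perm2 b a neq_ou).
apply: (@word_count _ _ _ b (fun y => traject y b (u + v)) (u + v) (rotr 1)).
  by move=> y; apply: joint_word.
move=> y w.
rewrite inE => /and3P[_ _ /eqP ya] wE.
have ltu : u < u + v by rewrite -{1}[val u]addn0 ltn_add2l.
have lt0 : o < u + v by rewrite o0 (leq_ltn_trans _ ltu).
by rewrite inE !wE // !nth_traject // o0 /= ya !eqxx.
Qed.

(** Writing c_j = y ^+ j b, so that c_u = a, commutation with y ^+ N gives
x c_s = c_r where s and r are the residues of u + N and N modulo u + v.  As
r is neither 0 nor u, position r of the word is not one of the two positions with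
a prescribed value. *)
Lemma card_joint_generic (o u : 'I_n) v : val o = 0 -> 0 < u -> 0 < v ->
    ~~ (u + v %| N) -> N %% (u + v) != u ->
  (n - 3) * #|joint_class u v| <= (n - 2)`!.
Proof.
move=> o0 u_gt0 v_gt0 nL nu; have neq_ou : o != u.
  by rewrite -val_eqE o0 /= eq_sym -lt0n.
have [->|[y0]] := set_0Vmem (joint_class u v); first by rewrite cards0 muln0.
rewrite inE => /and3P[_ /eqP L0 _].
have L_gt0 : 0 < u + v by rewrite addn_gt0 u_gt0.
have lt_n j : j < u + v -> j < n.
  by move=> ltj; apply: leq_trans ltj _; rewrite -L0 card_porbit_leq.
have lt_r := ltn_pmod N L_gt0; have lt_s := ltn_pmod (u + N) L_gt0.
pose r := Ordinal (lt_n _ lt_r); pose s := Ordinal (lt_n _ lt_s).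
have neq_ro : r != o by rewrite -val_eqE o0.
have neq_sr : s != r.
  rewrite -val_eqE /= -{2}[N]add0n eqn_modDr mod0n modn_small -?lt0n //.
  by rewrite -{1}[val u]addn0 ltn_add2l.
apply: leq_trans (card_perm3 b a x neq_ou neq_ro nu neq_sr).
rewrite leq_mul2l; apply/orP; right.
apply: (@word_count _ _ _ b (fun y => traject y b (u + v)) (u + v) (rotr 1)).
  by move=> y; apply: joint_word.
move=> y w Yy wE.
move: (Yy); rewrite inE => /and3P[Cy /eqP L /eqP ya].
have wI (j : 'I_n) : j < u + v -> w j = iter j y b.
  by move=> ltj; rewrite wE // nth_traject.
have ltu : u < u + v by rewrite -{1}[val u]addn0 ltn_add2l.
have lt0 : o < u + v by rewrite o0 (leq_ltn_trans _ ltu).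
rewrite inE !wI // o0 /= ya -L !iter_modn_porbit addnC iterD ya.
by rewrite commute_iter // xa !eqxx.
Qed.

Lemma power_centraliser_cover :
  power_centraliser \subset \bigcup_(q : 'I_n * 'I_n | (0 < q.1) && (0 < q.2))
     (split_class q.1 q.2 :|: joint_class q.1 q.2).
Proof.
apply/subsetP=> y Cy; have [ab|nab] := boolP (a \in porbit y b).
  move: (ab); rewrite porbit_traject => /trajectP[u ltu ya].
  have u_gt0 : 0 < u.
    by rewrite lt0n; apply: contra_neq neq_ab => u0; rewrite ya u0.
  have lt_n := card_porbit_leq y b.
  have ltv : #|porbit y b| - u < n.
    by apply: leq_trans lt_n; rewrite ltn_subrL u_gt0 (leq_ltn_trans _ ltu).
  apply/bigcupP; exists (Ordinal (leq_trans ltu lt_n), Ordinal ltv).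
    by rewrite /= u_gt0 subn_gt0.
  by rewrite inE; apply/orP; right; rewrite inE Cy /= -ya subnKC ?eqxx // ltnW.
have lt_uv : #|porbit y b| + #|porbit y a| <= n.
  have -> : #|porbit y b| + #|porbit y a| = #|porbit y b :|: porbit y a|.
    rewrite cardsU (_ : _ :&: _ = set0) ?cards0 ?subn0 //.
    apply/setP=> c; rewrite !inE; apply/negP=> /andP[cb ca].
    move: nab; rewrite -eq_porbit_mem; rewrite -!eq_porbit_mem in ca cb.
    by rewrite -(eqP ca) cb.
  by rewrite (leq_trans (max_card _)) ?card_ord.
have := card_porbit_gt0 y a; have := card_porbit_gt0 y b => u_gt0 v_gt0.
have ltu : #|porbit y b| < n by lia.
have ltv : #|porbit y a| < n by lia.
apply/bigcupP; exists (Ordinal ltu, Ordinal ltv); rewrite /= ?u_gt0 ?v_gt0 //.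
by rewrite inE; apply/orP; left; rewrite inE Cy nab !eqxx.
Qed.

End Commuting.

(** Since x conjugates y ^+ N to itself and sends a to b, the points a and b are
fixed by the same powers of y ^+ N; so the cycle lengths of a and b divide the
same multiples of N, and their p-parts divide N. *)
Lemma split_class_part n (x : 'S_n) (a b : 'I_n) N (p : nat) y u v :
    x a = b -> p.-nat N -> (forall l, 0 < l <= n -> l`_p %| N) ->
  y \in split_class x a b N u v -> u`_p^' = v`_p^'.
Proof.
move=> xa pN dvN; rewrite inE => /and4P[Cy _ /eqP<- /eqP<-].
have dv_l c : #|porbit y c|`_p %| N.
  by rewrite dvN // card_porbit_gt0 card_porbit_leq.
have fix_ab j : (#|porbit y a| %| N * j) = (#|porbit y b| %| N * j).
  rewrite -!permX_fix -xa expgM.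
  have := Cy; rewrite inE => /cent1P/commute_sym/(commuteX j).
  move: ((y ^+ N) ^+ j)%g => z xz.
  by rewrite -[z (x a)]permM xz permM (inj_eq perm_inj).
have half c c' :
    (forall j, (#|porbit y c| %| N * j) = (#|porbit y c'| %| N * j)) ->
    #|porbit y c'|`_p^' %| #|porbit y c|`_p^'.
  move=> E; have cop : coprime #|porbit y c'|`_p^' N.
    by rewrite coprime_sym (pnat_coprime pN) ?part_pnat.
  rewrite -(Gauss_dvdr _ cop); apply: dvdn_trans (dvdn_part _ _) _.
  rewrite -E -{1}(partnC p (card_porbit_gt0 y c)).
  by rewrite dvdn_mul.
by apply/eqP; rewrite eqn_dvd !half.
Qed.

(** * Counting exceptional pairs of lengths *)

(** Once u is fixed, v is determined by the exponent of p in v. *)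
Lemma card_same_part n p : prime p ->
  #|[set q : 'I_n * 'I_n | [&& 0 < q.1, 0 < q.2 & q.1`_p^' == q.2`_p^']]|
    <= (n - 1) * (trunc_log 2 n).+1.
Proof.
move=> p_pr; set P := [set q | _]; set K := trunc_log 2 n.
pose A := [set u : 'I_n | 0 < u].
have cardA : #|A| <= n - 1.
  case: n @A {P K} => [|n] A; first by rewrite (leq_trans (max_card _)) ?card_ord.
  rewrite subn1 /= -ltnS -[X in _ < X](card_ord n.+1) -cardsT proper_card //.
  by apply/properP; split=> //; exists ord0; rewrite !inE.
have lt_log (v : 'I_n) : logn p v < K.+1.
  have [->|v_gt0] := posnP v; first by rewrite logn0.
  rewrite ltnS trunc_log_max // (leq_trans _ (ltnW (ltn_ord v))) //.
  apply: leq_trans (dvdn_leq v_gt0 (pfactor_dvdnn p v)).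
  by case: (logn p v) => // l; rewrite leq_exp2r // prime_gt1.
pose h (q : 'I_n * 'I_n) : 'I_n * 'I_K.+1 := (q.1, Ordinal (lt_log q.2)).
have inj_h : {in P &, injective h}.
  move=> [u v] [u' v'] /[!inE] /= /and3P[_ v0 /eqP E] /and3P[_ v'0 /eqP E'].
  case=> eq_u eq_l; rewrite eq_u in E *; congr (_, _); apply: val_inj => /=.
  by rewrite -(partnC p v0) -(partnC p v'0) -E -E' !p_part eq_l.
rewrite -(card_in_imset inj_h).
apply: leq_trans (leq_mul cardA (leqnn _)).
rewrite -[X in _ * X]card_ord -[X in _ * X]cardsT -cardsX subset_leq_card //.
apply/subsetP=> _ /imsetP[q + ->]; rewrite !inE => /and3P[-> _ _] //.
Qed.

(** The sums L = u + v are powers of p.  The map (u, v) |-> u + L is injective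
because it takes its values in the intervals [L, 2L), which are disjoint for
distinct powers L of p. *)
Lemma card_dvd_sum n p N : prime p -> p.-nat N ->
  #|[set q : 'I_n * 'I_n |
     [&& 0 < q.1, 0 < q.2, q.1 + q.2 <= n & q.1 + q.2 %| N]]| <= 2 * n.
Proof.
move=> p_pr pN; set P := [set q | _].
have lt2 (q : 'I_n * 'I_n) : (q.1 + (q.1 + q.2)) %% (2 * n) < 2 * n.
  by rewrite ltn_mod; case: q => [[u ltu] _]; lia.
have inj_h : {in P &, injective (fun q => Ordinal (lt2 q))}.
  have pow q : q \in P -> [/\ 0 < q.1, 0 < q.2, q.1 + q.2 <= n
      & exists k, q.1 + q.2 = p ^ k].
    rewrite inE => /and4P[-> -> -> dv]; split=> //.
    by have [k ->] := p_natP (pnat_dvd dv pN); exists k.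
  have key (u v u' v' k k' : nat) : u + v = p ^ k -> u' + v' = p ^ k' -> 0 < v ->
      u + (u + v) = u' + (u' + v') -> k' <= k.
    move=> E E' v0 eqs; rewrite leqNgt; apply/negP=> ltk.
    have : p ^ k * 2 <= p ^ k'.
      apply: leq_trans (leq_pexp2l (prime_gt0 p_pr) ltk).
      by rewrite expnSr leq_mul // prime_gt1.
    rewrite -E -E'; lia.
  move=> [u v] [u' v'] /pow[/= u0 v0 len [k E]] /pow[/= u'0 v'0 len' [k' E']].
  case; rewrite /= !modn_small; try lia; move=> eqs.
  have eqk : k = k'.
    by apply/eqP; rewrite eqn_leq (key _ _ _ _ _ _ E' E) // (key _ _ _ _ _ _ E E').
  rewrite -eqk -E in E'.
  by congr (_, _); apply: val_inj => /=; lia.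
rewrite -(card_in_imset inj_h) -[X in _ <= X]card_ord; exact: max_card.
Qed.

(** Here u is determined by u + v. *)
Lemma card_mod_sum n N :
  #|[set q : 'I_n * 'I_n | (q.1 + q.2 <= n) && (N %% (q.1 + q.2) == q.1)]|
    <= n.+1.
Proof.
set P := [set q | _].
pose h (q : 'I_n * 'I_n) : 'I_n.+1 := inord (q.1 + q.2).
have inj_h : {in P &, injective h}.
  move=> [u v] [u' v'] /[!inE] /= /andP[le_n /eqP E] /andP[le_n' /eqP E'].
  move/(congr1 val); rewrite /= !inordK ?ltnS // => eqs.
  have equ : u = u' by apply: val_inj => /=; rewrite -E -E' eqs.
  by congr (_, _) => //; apply: val_inj; move: eqs; rewrite equ => /addnI.
rewrite -(card_in_imset inj_h) -[X in _ <= X]card_ord; exact: max_card.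
Qed.

(** * Nilpotent pairs in the symmetric group *)

Lemma trunc_log2_bound n : 18 < n -> 4 * (trunc_log 2 n).+1 <= n.+1.
Proof.
move=> n_gt; have := trunc_logP (ltnSn 1) (ltn_trans (ltn0Sn 17) n_gt).
move: (trunc_log 2 n) => K leK; case: (leqP K 4) => [|K_gt]; first by lia.
suffices : 4 * K.+1 <= 2 ^ K by lia.
elim: K K_gt {leK} => // [] [|[|[|[|[|K]]]]] // IHK _.
by rewrite expnS; have := IHK isT; lia.
Qed.

(** The permutations are distributed according to the pair (u, v).  In units of
(n - 2)`!, the exceptional pairs contribute at most
(n - 1) (log_2 n + 1) + 2 n + (n + 1), and the at most (n - 1)^2 remaining
cycles through a and b at most (n - 1)^2 / (n - 3) <= n + 2. *)
Lemma card_power_centraliser n (x : 'S_n) p N :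
    18 < n -> x != 1%g -> prime p -> p.-nat N ->
    (forall l, 0 < l <= n -> l`_p %| N) ->
  2 * #|power_centraliser x N| <= n`!.
Proof.
move=> n_gt x1 p_pr pN dvN.
have [a neq_a] : exists a, x a != a.
  apply/existsP; apply: contraNT x1 => /existsPn fix_x.
  by apply/eqP/permP=> c; rewrite perm1; apply/eqP; rewrite -[_ == _]negbK fix_x.
set b := x a in neq_a; have xa : x a = b by [].
have neq_ab : a != b by rewrite eq_sym.
pose o : 'I_n := Ordinal (ltn_trans (ltn0Sn 17) n_gt).
(* P1 lists the exceptional lengths for distinct cycles, P2 and P3 those for a
   common cycle. *)
pose M := (n - 2)`!; pose M' := M %/ (n - 3).
pose S := split_class x a b N; pose J := joint_class x a b N.
pose pos := [set q : 'I_n * 'I_n | (0 < q.1) && (0 < q.2)].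
pose P1 := [set q : 'I_n * 'I_n | [&& 0 < q.1, 0 < q.2 & q.1`_p^' == q.2`_p^']].
pose P2 := [set q : 'I_n * 'I_n |
  [&& 0 < q.1, 0 < q.2, q.1 + q.2 <= n & q.1 + q.2 %| N]].
pose P3 := [set q : 'I_n * 'I_n | (q.1 + q.2 <= n) && (N %% (q.1 + q.2) == q.1)].
have boundS q : q \in pos -> #|S q.1 q.2| <= (q \in P1) * M.
  rewrite inE => /andP[u0 v0]; have [->|[y Sy]] := set_0Vmem (S q.1 q.2).
    by rewrite cards0.
  rewrite inE u0 v0 (split_class_part xa pN dvN Sy) eqxx mul1n.
  by rewrite (@card_split_leq _ _ _ _ _ o).
have boundJ q : q \in pos -> #|J q.1 q.2| <= (q \in P2) * M + (q \in P3) * M + M'.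
  rewrite inE => /andP[u0 v0]; have [->|[y]] := set_0Vmem (J q.1 q.2).
    by rewrite cards0.
  rewrite inE => /and3P[_ /eqP L _].
  have le_n : q.1 + q.2 <= n by rewrite -L card_porbit_leq.
  have J_le : #|J q.1 q.2| <= M by apply: (@card_joint_leq _ _ _ _ _ o).
  rewrite !inE u0 v0 le_n /=.
  have [dv|ndv] := boolP (q.1 + q.2 %| N).
    by rewrite mul1n -addnA (leq_trans J_le) ?leq_addr.
  have [_|ne] := boolP (_ == _).
    by rewrite mul1n add0n (leq_trans J_le) ?leq_addr.
  rewrite leq_divRL; last by rewrite subn_gt0 (leq_trans _ n_gt).
  by rewrite mulnC (@card_joint_generic _ _ _ _ _ xa o).
have sumP (P : {set 'I_n * 'I_n}) : \sum_(q in pos) (q \in P) * M <= #|P| * M.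
  rewrite -big_distrl leq_mul2r; apply/orP; right.
  rewrite -sum1_card [X in X <= _]big_mkcond [X in _ <= X]big_mkcond /=.
  rewrite leq_sum // => q _.
  by case: ifP => // _; case: (q \in P).
have le_sum :
    #|power_centraliser x N| <= (#|P1| + #|P2| + #|P3|) * M + #|pos| * M'.
  apply: leq_trans (subset_leq_card (power_centraliser_cover x N neq_ab)) _.
  apply: (@leq_trans (\sum_(q in pos) (#|S q.1 q.2| + #|J q.1 q.2|))).
    under [X in _ <= X]eq_bigl => q do rewrite inE.
    elim/big_rec2: _ => [|q k A _ leA]; first by rewrite cards0.
    apply: leq_trans (leq_card_setU _ _) _; rewrite leq_add //.
    exact: leq_card_setU.
  apply: leq_trans (leq_sum _
    (fun q qpos => leq_add (boundS q qpos) (boundJ q qpos))) _.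
  by rewrite !big_split /= sum_nat_const !mulnDl -!addnA !leq_add ?sumP.
have card_pos : #|pos| <= (n - 1) * (n - 1).
  have -> : pos = setX [set~ o] [set~ o].
    by apply/setP=> q; rewrite !inE -!val_eqE /= !lt0n.
  by rewrite cardsX cardsC1 card_ord subn1.
have le1 := card_same_part n p_pr; have le2 := @card_dvd_sum n _ _ p_pr pN.
have le3 := card_mod_sum n N; rewrite -/P1 -/P2 -/P3 in le1 le2 le3.
have K_le := trunc_log2_bound n_gt; set K := (trunc_log 2 n).+1 in le1 K_le.
have M'_le : (n - 3) * M' <= M by rewrite mulnC leq_divM.
have pos_le : #|pos| * M' <= (n + 2) * M.
  apply: leq_trans (leq_mul (leqnn (n + 2)) M'_le).
  rewrite mulnA leq_mul2r; apply/orP; right; apply: leq_trans card_pos _.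
  by clear - n_gt; nia.
have n_gt' : 3 < n by lia.
have fact_n : n`! = n * (n - 1) * M.
  rewrite /M -mulnA -{1}(subnK (ltnW (ltnW n_gt'))) addn2 !factS.
  by congr (_ * (_ * _)); lia.
have tot_le := leq_trans le_sum (leq_add (leqnn _) pos_le).
apply: leq_trans (leq_mul (leqnn 2) tot_le) _.
rewrite fact_n -mulnDl mulnA leq_mul2r; apply/orP; right.
clear - n_gt le1 le2 le3 K_le; nia.
Qed.

(** The orders of y ^+ n`!`_p and of the p-part of x are coprime, since the order
of y divides n`!. *)
Lemma nilpotent_power_centraliser (p : nat_pred) n (x y : 'S_n) :
    nilpotent <<[set x; y]>>%g ->
  y \in power_centraliser (x.`_p)%g n`!`_p.
Proof.
move=> nilG; rewrite inE; apply/cent1P.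
have ord_y : #[(y ^+ n`!`_p)]%g %| n`!`_p^'.
  rewrite order_dvdn -expgM partnC ?fact_gt0 // -order_dvdn.
  by rewrite -card_Sn -cardsT order_dvdG ?inE.
have xG : x \in <<[set x; y]>>%g by rewrite mem_gen ?set21.
have yG : y \in <<[set x; y]>>%g by rewrite mem_gen ?set22.
have sub1 : (<[x.`_p]> \subset <<[set x; y]>>)%g.
  by rewrite cycle_subG groupX.
have sub2 : (<[y ^+ n`!`_p]> \subset <<[set x; y]>>)%g.
  by rewrite cycle_subG groupX.
have cop : coprime #|<[x.`_p]>%g| #|<[y ^+ n`!`_p]>%g|.
  rewrite (@pnat_coprime p) //; first exact: p_elt_constt.
  by apply: pnat_dvd ord_y _; apply: part_pnat.
have /subsetP/(_ _ (cycle_id (y ^+ n`!`_p)%g)) :=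
  sub_nilpotent_cent2 nilG sub1 sub2 cop.
by move=> /centP/(_ _ (cycle_id _)).
Qed.

Lemma card_nilpotentiser n (x : 'S_n) : 18 < n -> x != 1%g ->
  2 * #|[set y : 'S_n | ~~ nonnil_adj x y]| <= n`!.
Proof.
move=> n_gt x1; have ord_x : 1 < #[x]%g by rewrite order_gt1.
pose p := pdiv #[x]%g; have p_pr : prime p := pdiv_prime ord_x.
have xp1 : (x.`_p != 1)%g.
  rewrite -order_eq1 order_constt p_part_eq1 negbK.
  by rewrite pi_pdiv.
apply: leq_trans (card_power_centraliser n_gt xp1 p_pr (part_pnat p n`!) _).
  rewrite leq_mul2l subset_leq_card //; apply/subsetP=> y.
  by rewrite inE negbK => /(nilpotent_power_centraliser p).
by move=> l ?; rewrite partn_dvd ?fact_gt0 ?dvdn_fact.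
Qed.

Theorem mainTheorem4 (n : nat) (hn : 19 <= n) :
  nonnil_graph_hamiltonian [set: 'S_n]%G.
Proof.
rewrite /nonnil_graph_hamiltonian; set V := nonnil_vertices _.
have half (x : 'S_n) :
    x != 1%g -> n`! <= 2 * #|[set y : 'S_n | nonnil_adj x y]|.
  move=> /(card_nilpotentiser hn).
  have -> : [set y : 'S_n | ~~ nonnil_adj x y] = ~: [set y | nonnil_adj x y].
    by apply/setP=> y; rewrite !inE.
  by rewrite cardsCs setCK card_Sn; move: (n`!) #|_| => f c; lia.
have adj1 y : nonnil_adj (1%g : 'S_n) y = false.
  apply/negbF; rewrite (@nilpotentS _ <[y]>%G) ?abelian_nil ?cycle_abelian //.
  by rewrite gen_subG; apply/subsetP=> z /set2P[] ->; rewrite ?group1 ?cycle_id.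
have defV : V = [set~ 1%g].
  apply/setP=> x; rewrite !inE /=; apply/exists_inP/idP => [[y _]|x1].
    by apply: contraTneq => ->; rewrite adj1.
  have : 0 < #|[set y : 'S_n | nonnil_adj x y]|.
    by move: (half x x1) (fact_gt0 n); case: #|_| => //; case: n`!.
  by case/card_gt0P=> y; rewrite inE => xy; exists y; rewrite ?inE.
have cardV : #|V| = (n`!).-1 by rewrite defV cardsC1 card_Sn.
apply: (@dirac _ V _ (@nonnil_adj_sym _) (@nonnil_adj_irr _)).
  by rewrite cardV; move: (n`!) (leq_trans hn (fact_geq n)) => f; lia.
move=> x; rewrite {1}defV !inE => /half; rewrite cardV => half_x.
have -> : [set y in V | nonnil_adj x y] = [set y | nonnil_adj x y].
  apply/setP=> y; rewrite defV !inE; apply: andb_idl.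
  by apply: contraTneq => ->; rewrite nonnil_adj_sym adj1.
by apply: leq_trans half_x; rewrite leq_pred.
Qed.
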